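(* Let $(E,r)$ be a complete separable metric space, $A\subset C_b(E)\times C_b(E)$ and $\lambda>0$. Suppose $h\in C_b(E)$ and there exist $(f_n,g_n)\in A$, $n\ge1$, satisfying $\sup_x|\lambda f_n(x)-g_n(x)-h(x)|\to0$ as $n\to\infty$. Then the comparison principle holds for sequential viscosity semisolutions of $\lambda u-Au=h$, i.e. every sequential viscosity subsolution is pointwise less than or equal to every sequential viscosity supersolution.
   Context: $C_b(E)$ is the space of bounded continuous functions and $B(E)$ the bounded measurable functions on $E$. $A$ is a set of pairs (possibly multivalued operator). A function $u\in B(E)$ is a sequential viscosity subsolution of $\lambda u-Au=h$ if $u$ is upper semicontinuous and for each $(f,g)\in A$ and each sequence $y_n\in E$ satisfying $\lim_{n\to\infty}(u-f)(y_n)=\sup_x(u-f)(x)$ we have $\limsup_{n\to\infty}(\lambda u(y_n)-g(y_n)-h(y_n))\le0$. A function $u\in B(E)$ is a sequential viscosity supersolution if $u$ is lower semicontinuous and for each $(f,g)\in A$ and each sequence $y_n\in E$ satisfying $\lim_{n\to\infty}(u-f)(y_n)=\inf_x(u-f)(x)$ we have $\liminf_{n\to\infty}(\lambda u(y_n)-g(y_n)-h(y_n))\ge0$. *)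

(* Defs.v *)
From mathcomp Require Import all_boot all_order all_algebra.
From mathcomp Require Import all_classical all_reals all_analysis.

Set Implicit Arguments.
Unset Strict Implicit.
Unset Printing Implicit Defensive.

Import Order.TTheory GRing.Theory Num.Theory.
Import numFieldNormedType.Exports.

Local Open Scope classical_set_scope.
Local Open Scope ring_scope.

(* The library's [completeType] also requires a distinguished point; this is its
   Cauchy-filter axiom without that requirement, so that the empty space is
   not excluded. *)
Definition complete_space (T : uniformType) : Prop :=
  forall F : set_system T, ProperFilter F -> cauchy F -> exists x : T, F --> x.

Definition separable (T : topologicalType) : Prop :=
  exists2 D : set T, countable D & dense D.

Section sequential_viscosity.
Context {R : realType} {E : metricType R}.
Implicit Types (u v h : E -> R) (A : set ((E -> R) * (E -> R))).

Definition Cb : set (E -> R) := [set f | continuous f /\ bounded_fun f].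

(* Measurability is with respect to the Borel sigma-algebra <<s open >>;
   [measurable_fun] is not used because a [measurableType] must be pointed. *)
Definition borel_fun u : Prop :=
  forall B : set R, measurable B -> <<s @open E >> (u @^-1` B).

Definition Bb : set (E -> R) := [set u | borel_fun u /\ bounded_fun u].

(* Dual to the library's [lower_semicontinuous], which has no upper version. *)
Definition upper_semicontinuous u : Prop :=
  forall (x : E) (a : R), u x < a -> \forall y \near x, u y < a.

(* [sup] and [inf] are real-valued; they are the actual supremum and infimum as
   soon as f is bounded (A is contained in Cb x Cb in the theorem), since u is
   bounded and E contains the points y n. *)
Definition seq_viscosity_subsolution A (lambda : R) h u : Prop :=
  [/\ Bb u, upper_semicontinuous u &
    forall f g : E -> R, A (f, g) -> forall y : nat -> E,
      u (y n) - f (y n) @[n --> \oo] --> sup [set u x - f x | x in [set: E]] ->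
      (limn_esup (fun n => (lambda * u (y n) - g (y n) - h (y n))%:E) <= 0)%E].

Definition seq_viscosity_supersolution A (lambda : R) h v : Prop :=
  [/\ Bb v, lower_semicontinuous (EFin \o v) &
    forall f g : E -> R, A (f, g) -> forall y : nat -> E,
      v (y n) - f (y n) @[n --> \oo] --> inf [set v x - f x | x in [set: E]] ->
      (0 <= limn_einf (fun n => (lambda * v (y n) - g (y n) - h (y n))%:E))%E].

Definition comparison_principle A (lambda : R) h : Prop :=
  forall u v : E -> R,
    seq_viscosity_subsolution A lambda h u ->
    seq_viscosity_supersolution A lambda h v ->
    forall x : E, u x <= v x.

End sequential_viscosity.

(* Main.v *)
Require Import Defs.
From mathcomp Require Import all_boot all_order all_algebra.
From mathcomp Require Import all_classical all_reals all_analysis.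
From mathcomp Require Import lra.
Import Order.TTheory GRing.Theory Num.Theory.
Import numFieldNormedType.Exports.
Local Open Scope classical_set_scope.
Local Open Scope ring_scope.

(** Let [u] be a subsolution, [(f, g)] a pair of [A] and [eps] a bound for the
    residual [`|lambda * f - g - h|].  Along a sequence [y] that maximises
    [u - f] one has
      [lambda * (u - f) (y n) <= (lambda * u - g - h) (y n) + eps],
    where the left-hand side tends to [lambda * sup (u - f)] and the limsup of
    [lambda * u - g - h] is nonpositive.  Hence [lambda * (u - f) <= eps]
    everywhere.  Dually [lambda * (f - v) <= eps] for a supersolution [v], and
    adding the two inequalities eliminates [f] and [g]:
    [lambda * (u - v) <= 2 * eps].  The hypothesis on [A] lets [eps] tend to 0.

    Both halves are instances of [le_eps_of_maximizing], a statement about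
    maximising sequences of one function [w], used with [w = u - f] and with
    [w = f - v].  The test function [f], rather than the other semisolution,
    serves as the intermediary, so [u] and [v] may be tested along unrelated
    sequences. *)

Lemma bounded_fun_norm_le {R : realType} {T : Type} {f : T -> R} :
  bounded_fun f -> exists M, forall x, `|f x| <= M.
Proof.
case=> M [_ fM]; exists (M + 1) => x.
by apply: fM => //; rewrite ltrDl.
Qed.

Lemma has_ubound_range {R : realType} {T : Type} {f : T -> R} (M : R) :
  (forall x, f x <= M) -> has_ubound (range f).
Proof. by move=> fM; exists M => _ [x _ <-]. Qed.

Lemma maximizing_sequence {R : realType} {T : Type} {w : T -> R} (x0 : T) :
  has_ubound (range w) ->
  exists y : nat -> T, w (y n) @[n --> \oo] --> sup (range w).
Proof.
move=> wub; have wsup : has_sup (range w) by split=> //; exists (w x0), x0.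
have adh n : exists x, sup (range w) - harmonic n < w x.
  by have [_ [x _ <-] ?] := sup_adherent (harmonic_gt0 n) wsup; exists x.
have [y wy] := choice adh; exists y.
apply: (@squeeze_cvgr _ _ _ _ (fun n => sup (range w) - harmonic n)
                              (fun=> sup (range w))).
- apply: nearW => n; rewrite (ltW (wy n)) /=.
  by apply: ub_le_sup => //; exists (y n).
- rewrite -[X in _ --> X]subr0.
  by apply: cvgB; [exact: cvg_cst | exact: cvg_harmonic].
- exact: cvg_cst.
Qed.

Lemma le_limn_esup {R : realType} {a b : nat -> \bar R} :
  (forall n, (a n <= b n)%E) -> (limn_esup a <= limn_esup b)%E.
Proof.
move=> ab; apply/ereal_infP => _ [V FV <-].
apply: ge_ereal_inf; exists (ereal_sup (a @` V)); first by exists V.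
apply/ereal_supP => _ [n Vn <-].
by apply: le_ereal_sup_tmp; exists (b n); [exists n | exact: ab].
Qed.

(** What is common to sub- and supersolutions: [z] stands for the defect of the
    equation, whose limsup is controlled only along maximising sequences of
    [w].  That is enough, because one such sequence already sees the value
    [sup w]. *)
Lemma le_eps_of_maximizing {R : realType} {T : Type} {w : T -> R} (z : T -> R)
    {lambda eps : R} :
  0 < lambda -> has_ubound (range w) ->
  (forall x, lambda * w x <= z x + eps) ->
  (forall y : nat -> T, w (y n) @[n --> \oo] --> sup (range w) ->
     (limn_esup (fun n => (z (y n))%:E) <= 0)%E) ->
  forall x, lambda * w x <= eps.
Proof.
move=> l0 wub wz zmax x.
have [y wy] := maximizing_sequence x wub.
have wsup : w x <= sup (range w) by apply: ub_le_sup => //; exists x.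
apply: le_trans (_ : lambda * sup (range w) <= eps); first by rewrite ler_pM2l.
rewrite -subr_le0 -lee_fin; apply: le_trans (zmax y wy).
have cvg : (lambda * w (y n) - eps)%:E @[n --> \oo]
    --> (lambda * sup (range w) - eps)%:E.
  apply: cvg_EFin; first exact: nearW.
  by apply: cvgB; [apply: cvgMr | exact: cvg_cst].
rewrite -(cvg_limn_einf_sup cvg).2.
by apply: le_limn_esup => n; rewrite lee_fin lerBlDr.
Qed.

Section one_test_pair.
Context {R : realType} {E : metricType R}.
Context {A : set ((E -> R) * (E -> R))} {lambda eps : R} {h f g : E -> R}.
Hypotheses (lambda_gt0 : 0 < lambda) (Afg : A (f, g)) (f_bd : bounded_fun f).
Hypothesis residual : forall x, `|lambda * f x - g x - h x| <= eps.

Lemma subsolution_le {u} : seq_viscosity_subsolution A lambda h u ->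
  forall x, lambda * (u x - f x) <= eps.
Proof.
move=> [[_ u_bd] _ u_sub].
have [Mu uM] := bounded_fun_norm_le u_bd.
have [Mf fM] := bounded_fun_norm_le f_bd.
apply: (le_eps_of_maximizing (fun x => lambda * u x - g x - h x)) => //.
- apply: (has_ubound_range (Mu + Mf)) => x.
  by move: (uM x) (fM x); rewrite !ler_norml => /andP[? ?] /andP[? ?]; lra.
- by move=> x; move: (residual x); rewrite ler_norml => /andP[? ?]; lra.
- exact: u_sub.
Qed.

(** Since [inf (v - f) = - sup (f - v)], a minimising sequence of [v - f] is a
    maximising sequence of [f - v]; likewise the liminf of the defect is minus
    the limsup of the opposite defect. *)
Lemma supersolution_ge {v} : seq_viscosity_supersolution A lambda h v ->
  forall x, lambda * (f x - v x) <= eps.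
Proof.
move=> [[_ v_bd] _ v_super].
have [Mv vM] := bounded_fun_norm_le v_bd.
have [Mf fM] := bounded_fun_norm_le f_bd.
apply: (le_eps_of_maximizing (fun x => - (lambda * v x - g x - h x))) => //.
- apply: (has_ubound_range (Mv + Mf)) => x.
  by move: (vM x) (fM x); rewrite !ler_norml => /andP[? ?] /andP[? ?]; lra.
- by move=> x; move: (residual x); rewrite ler_norml => /andP[? ?]; lra.
- move=> y ymax.
  have infE : inf [set v x - f x | x in [set: E]]
      = - sup (range (fun x => f x - v x)).
    rewrite /inf image_comp; congr (- sup (_ @` _)).
    by apply/funext => x /=; rewrite opprB.
  have ymin : v (y n) - f (y n) @[n --> \oo]
      --> inf [set v x - f x | x in [set: E]].
    rewrite infE; under eq_fun do rewrite -opprB.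
    exact: cvgN.
  by have := v_super f g Afg y ymin; rewrite /limn_einf oppe_ge0.
Qed.

End one_test_pair.

(** Boundedness rules out the default value that the real-valued [sup] takes on
    sets without a supremum. *)
Lemma le_sup_residual {R : realType} {T : Type} (lambda : R) {f g h : T -> R} :
  bounded_fun f -> bounded_fun g -> bounded_fun h ->
  forall x, `|lambda * f x - g x - h x|
    <= sup [set `|lambda * f x - g x - h x| | x in [set: T]].
Proof.
move=> /bounded_fun_norm_le[Mf fM] /bounded_fun_norm_le[Mg gM].
move=> /bounded_fun_norm_le[Mh hM] x.
apply: ub_le_sup; last by exists x.
apply: (has_ubound_range (`|lambda| * Mf + Mg + Mh)) => {}x.
apply: le_trans (ler_normB _ _) (lerD _ (hM x)).
apply: le_trans (ler_normB _ _) (lerD _ (gM x)).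
by rewrite normrM ler_wpM2l.
Qed.

Theorem theorem4p8 (R : realType) (E : metricType R)
    (E_complete : complete_space E) (E_separable : separable E)
    (A : set ((E -> R) * (E -> R))) (A_Cb : A `<=` Cb `*` Cb)
    (lambda : R) (lambda_gt0 : 0 < lambda)
    (h : E -> R) (h_Cb : Cb h)
    (approx : exists f g : nat -> E -> R,
      (forall n, A (f n, g n)) /\
      sup [set `|lambda * f n x - g n x - h x| | x in [set: E]]
        @[n --> \oo] --> (0 : R)) :
  comparison_principle A lambda h.
Proof.
move=> u v u_sub v_super x; move: approx => [f [g [Afg eps0]]].
set eps := fun n => sup _ in eps0.
have le_2eps n : lambda * (u x - v x) <= eps n + eps n.
  have [[_ /= f_bd] [_ /= g_bd]] := A_Cb _ (Afg n).
  have residual := le_sup_residual lambda f_bd g_bd h_Cb.2.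
  have := subsolution_le lambda_gt0 (Afg n) f_bd residual u_sub x.
  have := supersolution_ge lambda_gt0 (Afg n) f_bd residual v_super x.
  by rewrite -/(eps n); lra.
rewrite -subr_le0 -(pmulr_rle0 _ lambda_gt0).
have two_eps0 : eps n + eps n @[n --> \oo] --> (0 : R).
  by rewrite -[X in _ --> X]addr0; apply: cvgD.
rewrite -(cvg_lim _ two_eps0) //.
apply: limr_ge; first by apply/cvg_ex; exists 0.
exact: nearW.
Qed.
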